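(* Fix $T>0$ and let $\mathcal X,\mathcal Y,\mathcal Z,\mathcal R:[0,T)\times\Omega\to\mathbb R$ be real valued, non-negative stochastic processes. Let $\tau<T$ be a stopping time such that $\mathbb E\int_0^\tau(\mathcal R\mathcal X+\mathcal Z)\,ds<\infty$, and assume that for some fixed deterministic constant $\kappa$, $\int_0^\tau\mathcal R\,ds<\kappa$ a.s. Then the following two conditions are equivalent: (i) there is a positive constant $C_0$, independent of the choice of $\tau',\tau''$, such that for all stopping times $0\le\tau'<\tau''\le\tau$, $$\mathbb E\Big(\sup_{s\in[\tau',\tau'']}\mathcal X+\int_{\tau'}^{\tau''}\mathcal Y\,ds\Big)\le C_0\,\mathbb E\Big(\mathcal X(\tau')+\int_{\tau'}^{\tau''}(\mathcal R\mathcal X+\mathcal Z)\,ds\Big);$$ (ii) there are $\varepsilon>0$ and a constant $C_\varepsilon$, which depends on $\varepsilon$ but not on the specific distributions of $\tau'$ and $\tau''$, such that for all stopping times $0\le\tau'<\tau''\le\tau$ with $\tau''-\tau'<\varepsilon$, $$\mathbb E\Big(\sup_{s\in[\tau',\tau'']}\mathcal X+\int_{\tau'}^{\tau''}\mathcal Y\,ds\Big)\le C_\varepsilon\,\mathbb E\Big(\mathcal X(\tau')+\int_{\tau'}^{\tau''}(\mathcal R\mathcal X+\mathcal Z)\,ds\Big).$$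
   Context: All processes and stopping times are defined on a common probability space $\Omega$ and stopping times are relative to a fixed underlying filtration. $\mathbb E$ denotes expectation.
   Formalization: In both (i) and (ii), τ'<τ'' is read as τ'≤τ'' everywhere with P(τ'<τ'')>0, since the lemma fails for pointwise (or a.s.) strict inequality; processes are taken jointly measurable, and the pathwise suprema of X are assumed measurable up to null sets. *)

(* Defs.v *)
From HB Require Import structures.
From mathcomp Require Import all_boot all_order all_algebra.
From mathcomp Require Import all_classical all_reals all_analysis.
From mathcomp Require Import measurable_realfun.
Set Implicit Arguments.
Unset Strict Implicit.
Unset Printing Implicit Defensive.
Import Order.TTheory GRing.Theory Num.Theory.
Import numFieldNormedType.Exports.
Local Open Scope classical_set_scope.
Local Open Scope ring_scope.

(* Time is the half-line [0, +oo); the values [F t] for [t < 0] are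
   irrelevant.  Neither right-continuity nor completeness is required. *)
Definition is_filtration d (Omega : measurableType d) (R : realType)
    (F : R -> set (set Omega)) : Prop :=
  [/\ forall t, 0 <= t -> sigma_algebra setT (F t),
      forall t, 0 <= t -> F t `<=` measurable &
      forall s t, 0 <= s -> s <= t -> F s `<=` F t].

(* Finite stopping times only: all those considered are bounded by some
   [tau < T]. *)
Definition stopping_time d (Omega : measurableType d) (R : realType)
    (F : R -> set (set Omega)) (tau : Omega -> R) : Prop :=
  (forall w, 0 <= tau w) /\
  (forall t, 0 <= t -> F t [set w | tau w <= t]).

(* Strict order between random times: the strict part of the (almost sure)
   pointwise order, i.e. [sigma <= rho] and the two times are not a.s. equal.
   The condition [forall w, sigma w < rho w] would be too restrictive.  If
   [F] is generated by the jump indicator t |-> 1_{tau <= t}, with [tau]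
   uniform on (0, 1], then the only stopping time lying everywhere strictly
   below [tau] is 0.  Short intervals then never get past time [epsilon], and
   local estimates say nothing about later times.  Splitting an interval at
   min(sigma + k * delta, rho) also yields pieces that are degenerate with
   positive probability. *)
Definition time_lt d (Omega : measurableType d) (R : realType)
    (P : probability Omega R) (sigma rho : Omega -> R) : Prop :=
  (forall w, sigma w <= rho w) /\
  (0 < P [set w | (sigma w < rho w)%R])%E.

(* A process on [0, T) is represented by a total function of time; only its
   values at times of [0, T) matter. *)
Definition nonneg_process d (Omega : measurableType d) (R : realType) (T : R)
    (X : R -> Omega -> R) : Prop :=
  measurable_fun (`[0, T[%classic `*` [set: Omega])
    (fun p : R * Omega => X p.1 p.2) /\
  (forall t w, 0 <= t -> t < T -> 0 <= X t w).

(* Pathwise supremum over the random interval [sigma, rho], possibly +oo. *)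
Definition path_sup d (Omega : measurableType d) (R : realType)
    (X : R -> Omega -> R) (sigma rho : Omega -> R) (w : Omega) : \bar R :=
  ereal_sup [set (X s w)%:E | s in `[sigma w, rho w]].

(* Pathwise Lebesgue integral over [sigma, rho], possibly +oo. *)
Definition path_int d (Omega : measurableType d) (R : realType)
    (X : R -> Omega -> R) (sigma rho : Omega -> R) (w : Omega) : \bar R :=
  (\int[lebesgue_measure]_(s in `[sigma w, rho w]) (X s w)%:E)%E.

(* Random variable for the P-completion of the sigma-algebra.  By the
   measurable projection theorem, [path_sup X sigma rho] is always of this
   form when [X] is jointly measurable and [sigma], [rho] are stopping times
   with [rho < T]; requiring it only makes its expectation well defined. *)
Definition ae_measurable d (Omega : measurableType d) (R : realType)
    (P : probability Omega R) (f : Omega -> \bar R) : Prop :=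
  exists2 g : Omega -> \bar R, measurable_fun [set: Omega] g & f = g %[ae P].

(* Main.v *)
Require Import Defs.
From mathcomp Require Import all_boot all_order all_algebra.
From mathcomp Require Import all_classical all_reals all_analysis.
From mathcomp Require Import measurable_realfun.
Import Order.TTheory GRing.Theory Num.Theory.
Import numFieldNormedType.Exports.
Local Open Scope classical_set_scope.
Local Open Scope ring_scope.

(** The global estimate (i) contains the local one (ii), with eps = 1.
    Conversely, let C >= 1 be a constant for the estimate on intervals shorter
    than eps and put delta = eps / 2.  Cut an interval [sigma, rho] at the
    stopping times min(sigma + k delta, rho); since rho < T, about T / delta
    pieces suffice, whatever sigma and rho are.

    Two adjacent pieces are glued by [sup_estimate_concat]: the supremum over
    the union is at most the sum of the suprema, and X(m), the initial value on
    the second piece [m, rho], is at most the supremum over the first piece,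
    which is already controlled.  So constants K on the first piece and C on
    the second give (1 + C) K on the union, and after n pieces the constant is
    (1 + C)^n ([sup_estimate_iterate]), which depends only on eps, C and T.

    Two points need care.  A piece may be almost surely degenerate, and then
    (ii) does not speak about it; but there both sides reduce to E X(sigma), and
    the estimate holds with constant 1 ([sup_estimate_degenerate]).  And pathwise
    suprema are measurable only up to a modification on a null set, while
    integrals of a sum split only for measurable summands; the first section
    shows that lower integrals of nonnegative functions do not see null sets, so
    that a measurable modification may be used instead. *)

(** * Integrals of functions equal to measurable ones almost everywhere *)

Section ae_integral.
Context {d : measure_display} {Omega : measurableType d} {R : realType}.
Variable mu : {measure set Omega -> \bar R}.
Implicit Types f g : Omega -> \bar R.
Local Open Scope ereal_scope.

Import HBNNSimple.

(** The integral of a nonnegative function is the supremum of the integrals of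
    the simple functions below it, measurable or not.  If h <= f is simple and
    N is the exceptional null set, then h 1_(~ N) is simple, lies below g
    everywhere and has the same integral as h. *)
Lemma ge0_le_integral_ae f g :
  (forall w, 0 <= f w) -> (forall w, 0 <= g w) ->
  {ae mu, forall w, f w <= g w} ->
  \int[mu]_w f w <= \int[mu]_w g w.
Proof.
move=> f0 g0 [N [mN N0 fgN]].
rewrite !ge0_integralTE//; apply: ge_ereal_sup => _ [h hf <-].
pose hN := proj_nnsfun h (measurableC mN).
have -> : sintegral mu h = sintegral mu hN.
  rewrite -!integralT_nnsfun; apply: ge0_ae_eq_integral => //.
  - exact/measurable_EFinP.
  - exact/measurable_EFinP.
  - by move=> w _; rewrite lee_fin.
  - by move=> w _; rewrite lee_fin; exact: fun_ge0.
  - exists N; split=> // w hw; apply: contrapT => Nw; apply: hw => _ /=.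
    by rewrite mindicE mem_set// mulr1.
apply: ereal_sup_ubound; exists hN => // w.
rewrite /hN /= mindicE; have [Nw|Nw] := pselect (N w).
  by rewrite memNset ?mulr0//; apply.
rewrite mem_set// mulr1 (le_trans (hf w))//.
by apply: contrapT => fg; apply/Nw/fgN.
Qed.

Lemma ge0_eq_integral_ae f g :
  (forall w, 0 <= f w) -> (forall w, 0 <= g w) ->
  f = g %[ae mu] -> \int[mu]_w f w = \int[mu]_w g w.
Proof.
move=> f0 g0 fg; apply/eqP; rewrite eq_le !ge0_le_integral_ae//.
  by apply: filterS fg => w /(_ I) ->.
by apply: filterS fg => w /(_ I) ->.
Qed.

End ae_integral.

Section ae_measurable.
Context {d : measure_display} {Omega : measurableType d} {R : realType}.
Variable P : probability Omega R.
Implicit Types f g : Omega -> \bar R.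
Local Open Scope ereal_scope.

Lemma ge0_ae_measurable_modification f :
  (forall w, 0 <= f w) -> ae_measurable P f ->
  exists g, [/\ measurable_fun setT g, forall w, 0 <= g w & f = g %[ae P]].
Proof.
move=> f0 [g mg fg]; exists (fun w => maxe 0 (g w)); split.
- exact: measurable_maxe.
- by move=> w; rewrite le_max lexx.
- by apply: filterS fg => w /(_ I) <- _; rewrite max_r.
Qed.

Lemma ae_measurableD f g :
  ae_measurable P f -> measurable_fun setT g -> ae_measurable P (f \+ g).
Proof.
move=> [f' mf' ff'] mg; exists (f' \+ g); first exact: emeasurable_funD.
by apply: filterS ff' => w /(_ I) /= ->.
Qed.

(** Lower integrals are only superadditive in general; passing to measurable
    modifications gives the other inequality. *)
Lemma ge0_integralD_ae f g :
  (forall w, 0 <= f w) -> (forall w, 0 <= g w) ->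
  ae_measurable P f -> ae_measurable P g ->
  \int[P]_w (f w + g w) = \int[P]_w f w + \int[P]_w g w.
Proof.
move=> f0 g0 /(ge0_ae_measurable_modification _ f0)[f' [mf' f'0 ff']].
move=> /(ge0_ae_measurable_modification _ g0)[g' [mg' g'0 gg']].
rewrite (ge0_eq_integral_ae P f f')// (ge0_eq_integral_ae P g g')//.
rewrite -ge0_integralD//; apply: ge0_eq_integral_ae.
- by move=> w; exact: adde_ge0.
- by move=> w; exact: adde_ge0.
- by apply: filterS2 ff' gg' => w /(_ I) -> /(_ I) ->.
Qed.

End ae_measurable.

(** * Stopping times *)

Section stopping_times.
Context {d : measure_display} {Omega : measurableType d} {R : realType}.
Variable F : R -> set (set Omega).
Hypothesis hF : is_filtration F.

Lemma filtration_setU t A B : 0 <= t -> F t A -> F t B -> F t (A `|` B).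
Proof.
move=> t0 FA FB; have [sF _ _] := hF; have [F0 _ FU] := sF _ t0.
rewrite -bigcup2E; apply: FU => n.
by rewrite /bigcup2; case: ifP => // _; case: ifP.
Qed.

Lemma stopping_time_measurable sigma :
  stopping_time F sigma -> measurable_fun setT sigma.
Proof.
move=> [s0 sF]; have [_ Fm _] := hF.
apply: (measurability _ (RGenOInfty.measurableE R)) => //.
move=> _ [_ [x ->] <-]; rewrite setTI.
have -> : sigma @^-1` `]x, +oo[ = ~` [set w | sigma w <= x].
  apply/seteqP; split=> w /=; rewrite in_itv/= andbT ltNge.
    by move/negP.
  by move=> H; apply/negP.
apply: measurableC; have [x0|x0] := leP 0 x; first exact/Fm/sF.
rewrite (_ : [set _ | _] = set0)//; apply/seteqP; split=> w //= sx.
by have := le_lt_trans (le_trans (s0 w) sx) x0; rewrite ltxx.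
Qed.

Lemma stopping_time_shift_min sigma rho c : 0 <= c ->
  stopping_time F sigma -> stopping_time F rho ->
  stopping_time F (fun w => Num.min (sigma w + c) (rho w)).
Proof.
move=> c0 [s0 sF] [r0 rF]; have [_ _ Fmono] := hF.
split=> [w|t t0]; first by rewrite le_min r0 addr_ge0.
have -> : [set w | Num.min (sigma w + c) (rho w) <= t] =
    [set w | sigma w <= t - c] `|` [set w | rho w <= t].
  apply/seteqP; split=> w /=; rewrite ge_min lerBrDr.
    by move=> /orP.
  by move=> H; apply/orP.
(* Before time c, the shifted time sigma + c cannot have occurred. *)
have [tc|tc] := leP 0 (t - c).
  apply: filtration_setU => //; last exact: rF.
  by apply: (Fmono (t - c)) => //; [rewrite gerBl|exact: sF].
rewrite (_ : [set w | sigma w <= t - c] = set0) ?set0U; first exact: rF.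
apply/seteqP; split=> w //= sx.
by have := le_lt_trans (le_trans (s0 w) sx) tc; rewrite ltxx.
Qed.

End stopping_times.

(** * Pathwise integrals of jointly measurable processes *)

Section process.
Context {d : measure_display} {Omega : measurableType d} {R : realType}.
Context {T : R}.
Implicit Types (X : R -> Omega -> R) (sigma rho m : Omega -> R).

Lemma nonneg_process_mulD X Y Z :
  nonneg_process T X -> nonneg_process T Y -> nonneg_process T Z ->
  nonneg_process T (fun s w => X s w * Y s w + Z s w).
Proof.
move=> [mX X0] [mY Y0] [mZ Z0]; split.
  by apply: measurable_funD => //; exact: measurable_funM.
by move=> t w t0 tT; rewrite addr_ge0 ?mulr_ge0 ?X0 ?Y0 ?Z0.
Qed.

Lemma measurable_process_at X sigma :
  nonneg_process T X -> measurable_fun setT sigma ->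
  (forall w, 0 <= sigma w) -> (forall w, sigma w < T) ->
  measurable_fun setT (fun w => (X (sigma w) w)%:E).
Proof.
move=> [mX _] ms s0 sT; apply/measurable_EFinP.
apply: (@measurable_comp _ _ _ _ _ _ (`[0, T[ `*` setT)
  (fun p : R * Omega => X p.1 p.2) setT (fun w => (sigma w, w))) => //.
- exact: measurableX.
- by move=> _ [w _ <-]; split=> //=; rewrite in_itv/= s0 sT.
- exact: measurable_fun_pair.
Qed.

Variables sigma rho : Omega -> R.
Hypotheses (ms : measurable_fun setT sigma) (mr : measurable_fun setT rho).
Hypotheses (s0 : forall w, 0 <= sigma w) (rT : forall w, rho w < T).

(** The random interval, as a subset of the product space: it turns
    [path_int X sigma rho w] into the integral over the first variable of one
    function on R * Omega, to which Tonelli's theorem applies. *)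
Let D : set (R * Omega) := [set p | sigma p.2 <= p.1 <= rho p.2].

Let measurable_D : measurable D.
Proof.
have -> : D = [set p | sigma p.2 <= p.1] `&` [set p | p.1 <= rho p.2].
  by apply/seteqP; split=> p /= /andP.
apply: measurableI.
- have := @measurable_fun_ler _ _ _ setT (sigma \o snd) (fst : R * Omega -> R).
  move=> /(_ _ _ measurableT [set true] I); rewrite setTI; apply=> //.
  exact: measurableT_comp.
- have := @measurable_fun_ler _ _ _ setT (fst : R * Omega -> R) (rho \o snd).
  move=> /(_ _ _ measurableT [set true] I); rewrite setTI; apply=> //.
  exact: measurableT_comp.
Qed.

Let f X : R * Omega -> \bar R := (fun p => (X p.1 p.2)%:E) \_ D.

Let in_D X : nonneg_process T X -> forall p, D p -> 0 <= X p.1 p.2.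
Proof.
move=> [_ X0] p /andP[sp pr].
by apply: X0; [exact: le_trans sp|exact: le_lt_trans pr (rT _)].
Qed.

Let measurable_f X : nonneg_process T X -> measurable_fun setT (f X).
Proof.
move=> [mX _]; apply/(measurable_restrictT _ measurable_D).
apply/measurable_EFinP; apply: measurable_funS mX; first exact: measurableX.
move=> p /andP[sp pr]; split=> //=.
by rewrite in_itv/= (le_trans (s0 _) sp) (le_lt_trans pr).
Qed.

Let f_section X w : (fun s => f X (s, w)) =
  (fun s => (X s w)%:E) \_ `[sigma w, rho w].
Proof.
apply/funext => s; rewrite /f /patch.
by congr (if _ then _ else _); apply/idP/idP; rewrite !inE /= in_itv.
Qed.

Lemma measurable_path_int X : nonneg_process T X ->
  measurable_fun setT (path_int X sigma rho).
Proof.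
move=> hX.
have := @measurable_fun_fubini_tonelli_G _ _ (measurableTypeR R) Omega R
  (@lebesgue_measure R) _
  (measurable_f _ hX).
rewrite (_ : fubini_G _ _ = path_int X sigma rho); last first.
  by apply/funext => w; rewrite /fubini_G f_section -integral_mkcond.
by apply=> p; apply: erestrict_ge0 => q /(in_D _ hX); rewrite lee_fin.
Qed.

Lemma measurable_path X w : nonneg_process T X ->
  measurable_fun `[sigma w, rho w] (fun s => (X s w)%:E).
Proof.
move=> /measurable_f mf; apply/measurable_restrictT => //.
by rewrite -f_section; exact: (measurable_fun_pair1 w mf).
Qed.

Lemma path_int_ge0 X w : nonneg_process T X -> (0 <= path_int X sigma rho w)%E.
Proof.
move=> hX; apply: integral_ge0 => s; rewrite /= in_itv/= => sw.
by rewrite lee_fin; exact: (in_D _ hX (s, w)).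
Qed.

Lemma path_int_split X m w : nonneg_process T X ->
  sigma w <= m w -> m w <= rho w ->
  path_int X sigma rho w = (path_int X sigma m w + path_int X m rho w)%E.
Proof.
move=> hX sm mr'; rewrite /path_int.
have E : [set` `[sigma w, rho w]] = `[sigma w, m w[ `|` `[m w, rho w].
  by apply: itv_bndbnd_setU; rewrite bnd_simp.
have mX := measurable_path X w hX.
rewrite E ge0_integral_setU//=.
- congr (_ + _)%E; apply: integral_itv_bndo_bndc.
  by apply: measurable_funS mX; rewrite // E; exact: subsetUl.
- by rewrite -E.
- move=> s sw; have {}sw : [set` `[sigma w, rho w]] s by rewrite E.
  move: sw; rewrite /= in_itv/= => sw; rewrite lee_fin; exact: (in_D _ hX (s, w)).
- apply/disj_setPS => s [] /=; rewrite !in_itv/= => /andP[_ s1] /andP[s2 _].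
  by have := lt_le_trans s1 s2; rewrite ltxx.
Qed.

End process.

(** * Pathwise suprema *)

Section path_sup.
Context {d : measure_display} {Omega : measurableType d} {R : realType}.
Implicit Types (X : R -> Omega -> R) (sigma rho m : Omega -> R).

Lemma path_sup_ubound X sigma rho w s :
  sigma w <= s <= rho w -> ((X s w)%:E <= path_sup X sigma rho w)%E.
Proof. by move=> sw; apply: ereal_sup_ubound; exists s => //=; rewrite in_itv. Qed.

Lemma path_sup_id X sigma rho w :
  sigma w = rho w -> path_sup X sigma rho w = (X (sigma w) w)%:E.
Proof. by rewrite /path_sup => <-; rewrite set_itv1 image_set1 ereal_sup1. Qed.

Lemma path_int_id X sigma rho w :
  sigma w = rho w -> path_int X sigma rho w = 0%E.
Proof. by rewrite /path_int => <-; rewrite set_itv1 integral_set1. Qed.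

Lemma path_sup_ge0 T X sigma rho w : nonneg_process T X ->
  0 <= sigma w -> sigma w <= rho w -> rho w < T ->
  (0 <= path_sup X sigma rho w)%E.
Proof.
move=> [_ X0] s0 sr rT; apply: (@le_trans _ _ (X (sigma w) w)%:E).
  by rewrite lee_fin X0// (le_lt_trans sr).
by apply: path_sup_ubound; rewrite lexx.
Qed.

Lemma path_sup_split T X sigma m rho w : nonneg_process T X ->
  0 <= sigma w -> sigma w <= m w -> m w <= rho w -> rho w < T ->
  (path_sup X sigma rho w <= path_sup X sigma m w + path_sup X m rho w)%E.
Proof.
move=> hX s0 sm mr rT; apply: ge_ereal_sup => _ [s + <-].
rewrite /= in_itv/= => /andP[ss sr].
have [sm'|/ltW sm'] := leP s (m w).
  apply: (le_trans (path_sup_ubound X sigma m w s _)); first by rewrite ss.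
  by apply: leeDl; apply: (path_sup_ge0 T) => //; exact: le_trans sm.
apply: (le_trans (path_sup_ubound X m rho w s _)); first by rewrite sm'.
by apply: leeDr; apply: (path_sup_ge0 T) => //; exact: le_lt_trans mr rT.
Qed.

End path_sup.

(** * Gluing estimates on consecutive random intervals *)

Section estimate.
Context {d : measure_display} {Omega : measurableType d} {R : realType}.
Variable P : probability Omega R.
Implicit Types (X Y W : R -> Omega -> R) (sigma rho m : Omega -> R).

Lemma not_time_lt_ae_eq sigma rho :
  measurable_fun setT sigma -> measurable_fun setT rho ->
  (forall w, sigma w <= rho w) -> ~ time_lt P sigma rho ->
  {ae P, forall w, sigma w = rho w}.
Proof.
move=> ms mr sr nlt; exists [set w | sigma w < rho w]; split.
- have /(_ measurableT [set true] I) := measurable_fun_ltr ms mr.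
  by rewrite setTI.
- apply/eqP; rewrite eq_le measure_ge0 andbT leNgt.
  by apply/negP => P0; exact: nlt.
- by move=> w /= /eqP sr'; rewrite lt_neqAle sr' sr.
Qed.

(** [W] is the source term; the theorem takes R X + Z. *)
Definition sup_estimate X Y W sigma rho (C : R) : Prop :=
  (\int[P]_w (path_sup X sigma rho w + path_int Y sigma rho w)
   <= C%:E * \int[P]_w ((X (sigma w) w)%:E + path_int W sigma rho w))%E.

Variables (F : R -> set (set Omega)) (T : R) (X Y W : R -> Omega -> R).
Variable tau : Omega -> R.
Hypotheses (hF : is_filtration F) (hX : nonneg_process T X).
Hypotheses (hY : nonneg_process T Y) (hW : nonneg_process T W).
Hypothesis htauT : forall w, tau w < T.
Hypothesis hsup : forall sigma rho,
  stopping_time F sigma -> stopping_time F rho ->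
  time_lt P sigma rho -> (forall w, rho w <= tau w) ->
  ae_measurable P (path_sup X sigma rho).

Let before_T rho : (forall w, rho w <= tau w) -> forall w, rho w < T.
Proof. by move=> rt w; exact: le_lt_trans (rt w) (htauT w). Qed.

Let X_ge0 sigma w : 0 <= sigma w -> sigma w < T -> (0 <= (X (sigma w) w)%:E)%E.
Proof. by move=> s0 sT; rewrite lee_fin; have [_] := hX; apply. Qed.

(** On a degenerate interval the supremum is X(sigma), which is measurable
    because X is jointly measurable. *)
Lemma ae_measurable_path_sup sigma rho :
  stopping_time F sigma -> stopping_time F rho ->
  (forall w, sigma w <= rho w) -> (forall w, rho w <= tau w) ->
  ae_measurable P (path_sup X sigma rho).
Proof.
move=> hs hr sr rt; have [lt|nlt] := pselect (time_lt P sigma rho).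
  exact: hsup.
have ms := stopping_time_measurable _ hF _ hs.
have mr := stopping_time_measurable _ hF _ hr.
exists (fun w => (X (sigma w) w)%:E).
  apply: (measurable_process_at _ _ hX ms) => w; first by case: hs.
  exact: le_lt_trans (sr w) (before_T _ rt w).
by apply: filterS (not_time_lt_ae_eq _ _ ms mr sr nlt) => w + _; exact: path_sup_id.
Qed.

Lemma sup_estimate_weaken sigma rho C C' : C <= C' ->
  stopping_time F sigma ->
  (forall w, sigma w <= rho w) -> (forall w, rho w <= tau w) ->
  sup_estimate X Y W sigma rho C -> sup_estimate X Y W sigma rho C'.
Proof.
move=> CC' [s0 _] sr /before_T rT /le_trans; apply.
apply: lee_wpmul2r; rewrite ?lee_fin//; apply: integral_ge0 => w _.
apply: adde_ge0; last exact: (path_int_ge0 _ _ s0 rT).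
by apply: X_ge0 => //; exact: le_lt_trans (sr w) (rT w).
Qed.

(** Both the supremum and X(sigma) + 0 agree with X(sigma) almost surely, and
    the integral of Y over a point vanishes. *)
Lemma sup_estimate_degenerate sigma rho :
  stopping_time F sigma ->
  (forall w, sigma w <= rho w) -> (forall w, rho w <= tau w) ->
  {ae P, forall w, sigma w = rho w} -> sup_estimate X Y W sigma rho 1.
Proof.
move=> [s0 _] sr /before_T rT eq_sr; rewrite /sup_estimate mul1e.
have sT w : sigma w < T by exact: le_lt_trans (sr w) (rT w).
apply: ge0_le_integral_ae.
- move=> w; apply: adde_ge0; last exact: (path_int_ge0 _ _ s0 rT).
  exact: (path_sup_ge0 T).
- move=> w; apply: adde_ge0; last exact: (path_int_ge0 _ _ s0 rT).
  exact: X_ge0.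
- by apply: filterS eq_sr => w E; rewrite path_sup_id// !path_int_id.
Qed.

(** Write A and B for the left-hand sides on the two pieces, G for the
    right-hand expectation on the first one and w2 for the expected integral of
    W over the second.  Since E X(m) <= A,
    A + B <= A + C (A + w2) <= (1 + C) (A + w2) <= (1 + C) K (G + w2). *)
Lemma sup_estimate_concat sigma m rho K C : 0 <= C -> 1 <= K ->
  stopping_time F sigma -> stopping_time F m -> stopping_time F rho ->
  (forall w, sigma w <= m w) -> (forall w, m w <= rho w) ->
  (forall w, rho w <= tau w) ->
  sup_estimate X Y W sigma m K -> sup_estimate X Y W m rho C ->
  sup_estimate X Y W sigma rho ((1 + C) * K).
Proof.
move=> C0 K1 hs hm hr sm mr rt est1 est2.
have [[s0 _] [m0 _]] := (hs, hm).
have mt w : m w <= tau w by exact: le_trans (mr w) (rt w).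
have rT := before_T _ rt; have mT := before_T _ mt.
have sT w : sigma w < T by exact: le_lt_trans (sm w) (mT w).
have sr w : sigma w <= rho w by exact: le_trans (sm w) (mr w).
have ms := stopping_time_measurable _ hF _ hs.
have mm := stopping_time_measurable _ hF _ hm.
have mrho := stopping_time_measurable _ hF _ hr.
have mI Z : nonneg_process T Z -> measurable_fun setT (path_int Z sigma m) /\
    measurable_fun setT (path_int Z m rho).
  by move=> hZ; split; exact: measurable_path_int.
have I0 Z w : nonneg_process T Z -> [/\ (0 <= path_int Z sigma m w)%E,
    (0 <= path_int Z m rho w)%E & (0 <= path_int Z sigma rho w)%E].
  by move=> hZ; split; exact: path_int_ge0.
have [mY1 mY2] := mI Y hY; have [mW1 mW2] := mI W hW.
have Xs0 w : (0 <= (X (sigma w) w)%:E)%E by exact: X_ge0.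
have Xm0 w : (0 <= (X (m w) w)%:E)%E by exact: X_ge0.
have mXs := measurable_process_at _ _ hX ms s0 sT.
have mXm := measurable_process_at _ _ hX mm m0 mT.
have S10 w : (0 <= path_sup X sigma m w)%E by exact: (path_sup_ge0 T).
have S20 w : (0 <= path_sup X m rho w)%E by exact: (path_sup_ge0 T).
have aS1 := ae_measurable_path_sup _ _ hs hm sm mt.
have aS2 := ae_measurable_path_sup _ _ hm hr mr rt.
pose f1 w := (path_sup X sigma m w + path_int Y sigma m w)%E.
pose f2 w := (path_sup X m rho w + path_int Y m rho w)%E.
pose g1 w := ((X (sigma w) w)%:E + path_int W sigma m w)%E.
have f10 w : (0 <= f1 w)%E by apply: adde_ge0 => //; case: (I0 Y w hY).
have f20 w : (0 <= f2 w)%E by apply: adde_ge0 => //; case: (I0 Y w hY).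
have g10 w : (0 <= g1 w)%E by apply: adde_ge0 => //; case: (I0 W w hW).
have W20 w : (0 <= path_int W m rho w)%E by case: (I0 W w hW).
have split_lhs : (\int[P]_w (path_sup X sigma rho w + path_int Y sigma rho w)
    <= \int[P]_w f1 w + \int[P]_w f2 w)%E.
  rewrite -ge0_integralD_ae//; [|exact: ae_measurableD|exact: ae_measurableD].
  apply: ge0_le_integral_ae.
  - by move=> w; apply: adde_ge0; [exact: (path_sup_ge0 T)|case: (I0 Y w hY)].
  - by move=> w; exact: adde_ge0.
  - apply: aeW => w; rewrite /f1 /f2 addeACA (path_int_split _ _ ms mrho s0 rT _ m)//.
    by apply: leeD => //; exact: (path_sup_split T).
have split_rhs : (\int[P]_w ((X (sigma w) w)%:E + path_int W sigma rho w)
    = \int[P]_w g1 w + \int[P]_w path_int W m rho w)%E.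
  transitivity (\int[P]_w (g1 w + path_int W m rho w))%E.
    apply: eq_integral => w _; rewrite /g1 -addeA.
    by rewrite (path_int_split _ _ ms mrho s0 rT _ m).
  by apply: ge0_integralD => //; exact: emeasurable_funD.
have split_mid : (\int[P]_w ((X (m w) w)%:E + path_int W m rho w)
    = \int[P]_w (X (m w) w)%:E + \int[P]_w path_int W m rho w)%E.
  exact: ge0_integralD.
have Xm_le : (\int[P]_w (X (m w) w)%:E <= \int[P]_w f1 w)%E.
  apply: ge0_le_integral_ae => //; apply: aeW => w.
  apply: (@le_trans _ _ (path_sup X sigma m w)).
    by apply: path_sup_ubound; rewrite sm lexx.
  by apply: leeDl; case: (I0 Y w hY).
move: est1 est2; rewrite /sup_estimate -/f1 -/f2 -/g1.
rewrite split_mid split_rhs => est1 est2.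
set A := (\int[P]_w f1 w)%E in est1 Xm_le split_lhs.
set G := (\int[P]_w g1 w)%E in est1 split_rhs *.
set w2 := (\int[P]_w path_int W m rho w)%E in est2 split_rhs *.
have A0 : (0 <= A)%E by apply: integral_ge0 => w _.
have w20 : (0 <= w2)%E by apply: integral_ge0 => w _.
have G0 : (0 <= G)%E by apply: integral_ge0 => w _.
apply: (le_trans split_lhs).
apply: (@le_trans _ _ (A + C%:E * (A + w2))%E).
  by rewrite leeD2l// (le_trans est2)// lee_wpmul2l// leeD2r.
apply: (@le_trans _ _ ((1 + C)%:E * (A + w2))%E).
  by rewrite EFinD ge0_muleDl// mul1e leeD2r// leeDl.
rewrite EFinM -muleA lee_wpmul2l ?lee_fin ?addr_ge0//.
by rewrite ge0_muleDr// leeD// lee_pemull.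
Qed.

(** By induction on n, cutting off the last piece: the induction hypothesis
    covers [sigma, m] with m = min(sigma + n eps / 2, rho), and [m, rho] is
    shorter than eps, hence is covered by the local estimate or is almost
    surely degenerate. *)
Lemma sup_estimate_iterate eps C : 0 < eps -> 1 <= C ->
  (forall sigma rho, stopping_time F sigma -> stopping_time F rho ->
     time_lt P sigma rho -> (forall w, rho w <= tau w) ->
     (forall w, rho w - sigma w < eps) -> sup_estimate X Y W sigma rho C) ->
  forall n sigma rho, stopping_time F sigma -> stopping_time F rho ->
    (forall w, sigma w <= rho w) -> (forall w, rho w <= tau w) ->
    (forall w, rho w <= sigma w + n%:R * (eps / 2)) ->
    sup_estimate X Y W sigma rho ((1 + C) ^+ n).
Proof.
move=> eps0 C1 local; elim=> [|n IHn] sigma rho hs hr sr rt rn.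
  rewrite expr0; apply: sup_estimate_degenerate => //; apply: aeW => w.
  by apply/eqP; rewrite eq_le sr (le_trans (rn w))// mul0r addr0.
have nd0 : 0 <= n%:R * (eps / 2) by rewrite mulr_ge0// ltW// divr_gt0.
pose m w := Num.min (sigma w + n%:R * (eps / 2)) (rho w).
have hm : stopping_time F m by exact: stopping_time_shift_min.
have sm w : sigma w <= m w by rewrite le_min sr lerDl nd0.
have mr w : m w <= rho w by rewrite ge_min lexx orbT.
have mt w : m w <= tau w by exact: le_trans (mr w) (rt w).
have gap w : rho w - m w < eps.
  apply: (@le_lt_trans _ _ (eps / 2)); last by rewrite gtr_pMr// invf_lt1// ltr1n.
  rewrite lerBlDr [leRHS]addrC -lerBlDr le_min; apply/andP; split.
    by rewrite lerBlDr (le_trans (rn w))// -natr1 mulrDl mul1r addrA.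
  by rewrite gerBl ltW// divr_gt0.
rewrite exprS; apply: (sup_estimate_concat _ m) => //.
- exact: le_trans C1.
- by rewrite exprn_ege1// lerDl (le_trans _ C1).
- by apply: (IHn sigma m) => // w; rewrite ge_min lexx.
have [lt|nlt] := pselect (time_lt P m rho); first exact: local.
apply: (sup_estimate_weaken _ _ _ _ C1) => //.
apply: sup_estimate_degenerate => //; apply: not_time_lt_ae_eq => //.
  exact: (stopping_time_measurable _ hF).
exact: (stopping_time_measurable _ hF).
Qed.

End estimate.

(** * Equivalence of the global and the local estimate *)

Theorem lemma4p2 (R : realType) (d : measure_display)
  (Omega : measurableType d) (P : probability Omega R)
  (F : R -> set (set Omega)) (hF : is_filtration F)
  (T : R) (hT : 0 < T)
  (calX calY calZ calR : R -> Omega -> R)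
  (hX : nonneg_process T calX) (hY : nonneg_process T calY)
  (hZ : nonneg_process T calZ) (hR : nonneg_process T calR)
  (tau : Omega -> R) (htau : stopping_time F tau)
  (htauT : forall w, tau w < T)
  (hsup : forall sigma rho : Omega -> R,
     stopping_time F sigma -> stopping_time F rho ->
     time_lt P sigma rho -> (forall w, rho w <= tau w) ->
     ae_measurable P (path_sup calX sigma rho))
  (hint : (\int[P]_w path_int (fun s w => (calR s w * calX s w + calZ s w)%R)
             (fun=> 0%R) tau w < +oo)%E)
  (kappa : R)
  (hkappa : {ae P, forall w, (path_int calR (fun=> 0%R) tau w < kappa%:E)%E}) :
  (exists C0 : R, 0 < C0 /\
     forall sigma rho : Omega -> R,
       stopping_time F sigma -> stopping_time F rho ->
       time_lt P sigma rho -> (forall w, rho w <= tau w) ->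
       (\int[P]_w (path_sup calX sigma rho w + path_int calY sigma rho w)
        <= C0%:E *
           \int[P]_w ((calX (sigma w) w)%:E +
              path_int (fun s w => (calR s w * calX s w + calZ s w)%R)
                sigma rho w))%E)
  <->
  (exists eps Ceps : R, 0 < eps /\
     forall sigma rho : Omega -> R,
       stopping_time F sigma -> stopping_time F rho ->
       time_lt P sigma rho -> (forall w, rho w <= tau w) ->
       (forall w, rho w - sigma w < eps) ->
       (\int[P]_w (path_sup calX sigma rho w + path_int calY sigma rho w)
        <= Ceps%:E *
           \int[P]_w ((calX (sigma w) w)%:E +
              path_int (fun s w => (calR s w * calX s w + calZ s w)%R)
                sigma rho w))%E).

Proof.
set W := fun s w => calR s w * calX s w + calZ s w.
have hW : nonneg_process T W by exact: nonneg_process_mulD.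
split=> [[C0 [C00 est]]|[eps [C [eps0 est]]]].
  by exists 1, C0; split=> // sigma rho hs hr lt rt _; exact: est.
(* The constant of (ii) may be small or even negative, while degenerate pieces
   and the induction ask for a constant at least 1. *)
pose C1 := Num.max 1 C.
have C11 : 1 <= C1 by rewrite le_max lexx.
have local sigma rho : stopping_time F sigma -> stopping_time F rho ->
    time_lt P sigma rho -> (forall w, rho w <= tau w) ->
    (forall w, rho w - sigma w < eps) ->
    sup_estimate P calX calY W sigma rho C1.
  move=> hs hr lt rt gap; have [sr _] := lt.
  apply: (sup_estimate_weaken P F T calX calY W tau hX hW htauT _ _ C) => //.
    by rewrite le_max lexx orbT.
  exact: est.
have d0 : 0 < eps / 2 by rewrite divr_gt0.
pose n := Num.bound (T / (eps / 2)).
exists ((1 + C1) ^+ n); split.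
  by rewrite exprn_gt0// ltr_pwDl// (le_trans _ C11).
move=> sigma rho hs hr [sr _] rt.
apply: (sup_estimate_iterate P F T calX calY W tau hF hX hY hW htauT hsup
  eps C1 eps0 C11 local) => // w.
have [s0 _] := hs.
rewrite (le_trans (rt w))// (le_trans (ltW (htauT w)))//.
apply: ler_wpDl => //; rewrite -ler_pdivrMr// ltW//.
by rewrite archi_boundP// ltW// divr_gt0.
Qed.
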